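(* Let $p>2$ be a prime, let $n\ge 1$ be a natural number with $n\le p-2$, and let $a_1,a_2,\ldots,a_n$ be integers such that $p$ does not divide $a_1a_2\cdots a_n$. With the integers $V_{i,h}$ defined from $a_1,\ldots,a_n$ as in the context, the congruence $$x^n+a_1x^{n-1}+a_2x^{n-2}+\cdots+a_n\equiv 0 \pmod p,\qquad 0<x<p,$$ has $n$ roots if and only if $$V_{p,i}\equiv V_{1,i}\pmod p\quad\text{for } i=2,3,4,\ldots,n.$$
   Context: Let $\zeta_1,\ldots,\zeta_n\in\mathbb{C}$ be the roots, listed with multiplicity, of $\zeta^n+a_1\zeta^{n-1}+a_2\zeta^{n-2}+\cdots+a_n=0$. For integers $i\ge h$ with $1\le h\le n$, define $$V_{i,h}=\sum \zeta_1^{e_1}\zeta_2^{e_2}\cdots\zeta_n^{e_n},$$ where the sum is over all $n$-tuples $(e_1,\ldots,e_n)$ of non-negative integers such that $e_1+\cdots+e_n=i$ and exactly $h$ of $e_1,\ldots,e_n$ are non-zero. If $i<h$, set $V_{i,h}=0$. Since they are symmetric polynomials with integer coefficients in the roots, the $V_{i,h}$ are integers. ''The congruence has $n$ roots'' means that there are exactly $n$ distinct integers $x$ with $0<x<p$ satisfying it. *)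

(* Defs.v *)
From HB Require Import structures.
From mathcomp Require Import all_boot all_order all_fingroup all_algebra.
From mathcomp Require Import reals complex mpoly.

Set Implicit Arguments.
Unset Strict Implicit.
Unset Printing Implicit Defensive.

Import GRing.Theory Num.Theory.

Local Open Scope ring_scope.

(* X^n + a_1 X^(n-1) + ... + a_n; only the values a 1, ..., a n are used. *)
Definition fpoly (n : nat) (a : nat -> int) : {poly int} :=
  'X^n + \sum_(1 <= k < n.+1) (a k) *: 'X^(n - k).

(* zeta lists the complex roots of fpoly n a with multiplicity. *)
Definition roots_of (R : realType) (n : nat) (a : nat -> int)
    (zeta : 'I_n -> R[i]) : Prop :=
  map_poly intr (fpoly n a) = \prod_(j < n) ('X - (zeta j)%:P).

(* Exponent tuples whose sum is i have all their entries in {0, ..., i}, so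
   it is enough to range over {ffun 'I_n -> 'I_i.+1}. *)
Definition expo (n i h : nat) (e : {ffun 'I_n -> 'I_i.+1}) : bool :=
  ((\sum_(j < n) e j)%N == i) && (#|[set j | val (e j) != 0%N]| == h).

Definition VC (R : realType) (n : nat) (zeta : 'I_n -> R[i]) (i h : nat) :
    R[i] :=
  if (i < h)%N then 0
  else \sum_(e : {ffun 'I_n -> 'I_i.+1} | expo h e) \prod_(j < n) zeta j ^+ e j.

(* V_{i,h} as an element of int: when zeta lists the roots of a monic integer
   polynomial, VC zeta i h is an integer, and V zeta i h is that integer; see
   V_VC below. The floor of the real part only serves to read it off. *)
Definition V (R : realType) (n : nat) (zeta : 'I_n -> R[i]) (i h : nat) : int :=
  Num.floor (complex.Re (VC zeta i h)).

Section Integrality.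

Variable n : nat.

Local Notation es := (@mesym n _).

Let Vmp (i h : nat) : {mpoly int[n]} :=
  \sum_(e : {ffun 'I_n -> 'I_i.+1} | expo h e)
    'X_[[multinom (e j : nat) | j < n]].

Lemma Vmp_sym i h : Vmp i h \is symmetric.
Proof.
apply/issymP => s; rewrite /Vmp raddf_sum /=.
pose F (t : 'S_n) (e : {ffun 'I_n -> 'I_i.+1}) := [ffun j => e (t j)].
have FK t : cancel (F t) (F t^-1%g).
  by move=> e; apply/ffunP => j; rewrite !ffunE permKV.
rewrite (reindex_onto (F s) (F s^-1%g)); last first.
  by move=> e _; rewrite -{1}[s]invgK; exact: FK.
apply: eq_big => [e | e _].
  rewrite FK eqxx andbT /expo; congr (_ && _).
    rewrite [in RHS](reindex_inj (@perm_inj _ s)) /=; congr (_ == _).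
    by apply: eq_bigr => j _; rewrite ffunE.
  rewrite -(card_preimset [set j | val (e j) != 0%N] (@perm_inj _ s)).
  suff -> : [set j | val (F s e j) != 0%N] =
            s @^-1: [set j | val (e j) != 0%N] by [].
  by apply/setP => j; rewrite !inE ffunE.
rewrite msymX; congr 'X_[_]; apply/mnmP => j.
by rewrite !mnmE ffunE permKV.
Qed.

Variables (R : realType) (a : nat -> int) (zeta : 'I_n -> R[i]).
Hypothesis zetaP : roots_of a zeta.

Let f : {mpoly int[n]} -> R[i] := mmap intr zeta.

Lemma mesym_int (k : 'I_n.+1) : exists b : int, f (es k) = b%:~R.
Proof.
pose cs : n.-tuple R[i] := [tuple zeta j | j < n].
have csE : tnth cs =1 zeta by move=> j; rewrite tnth_mktuple.
have -> : f (es k) = (es k).@[tnth cs].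
  rewrite /f /mesym !raddf_sum /=; apply: eq_bigr => A _.
  rewrite !rmorph_prod /=; apply: eq_bigr => j _.
  by rewrite mmapX mmap1U mevalXU csE.
exists ((-1) ^+ k * (fpoly n a)`_(n - k)).
rewrite rmorphM rmorphXn rmorphN1 -[X in _ * X]coef_map zetaP /=.
have -> : \prod_(j < n) ('X - (zeta j)%:P) = \prod_(c <- cs) ('X - c%:P).
  by rewrite big_tuple; apply: eq_bigr => j _; rewrite csE.
by rewrite mroots_coeff mulrA -exprMn mulrNN mulr1 expr1n mul1r.
Qed.

Lemma VC_int i h : exists m : int, VC zeta i h = m%:~R.
Proof.
rewrite /VC; case: ltnP => _; first by exists 0; rewrite mulr0z.
have -> : \sum_(e : {ffun 'I_n -> 'I_i.+1} | expo h e)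
            \prod_(j < n) zeta j ^+ e j = f (Vmp i h).
  rewrite /f /Vmp raddf_sum /=; apply: eq_bigr => e _.
  by rewrite mmapX /mmap1; apply: eq_bigr => j _; rewrite mnmE.
have [t [<- _]] := sym_fundamental (Vmp_sym i h).
have [b bE] : exists b : 'I_n -> int, forall j : 'I_n,
    f (es j.+1) = (b j)%:~R.
  have /fin_all_exists [b bE] : forall j : 'I_n, exists b : int,
      f (es j.+1) = b%:~R.
    by move=> j; exact: (@mesym_int (lift ord0 j)).
  by exists b.
exists (\sum_(m <- msupp t) t@_m * \prod_(j < n) b j ^+ m j).
rewrite comp_mpolyEX /f raddf_sum rmorph_sum /=; apply: eq_bigr => m _.
rewrite mmapZ rmorphM /=; congr (_ * _).
rewrite comp_mpolyX !rmorph_prod /=; apply: eq_bigr => j _.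
by rewrite !rmorphXn /= tnth_mktuple -bE.
Qed.

Lemma V_VC i h : (V zeta i h)%:~R = VC zeta i h.
Proof.
have [m mE] := VC_int i h; rewrite /V mE.
have -> : complex.Re (m%:~R : R[i]) = m%:~R.
  by rewrite -(rmorph_int (real_complex R)).
by rewrite intrKfloor.
Qed.

End Integrality.

(* Main.v *)
Require Import Defs.
From HB Require Import structures.
From mathcomp Require Import all_boot all_order all_algebra all_field.
From mathcomp Require Import reals complex ring zify.

(** Write f = X^n + a_1 X^(n-1) + ... + a_n and let
    g = 1 + a_1 X + ... + a_n X^n = (1 - zeta_1 X) ... (1 - zeta_n X) be its
    reciprocal polynomial. Let h = sum_k h_k X^k be the inverse of g as a power
    series; since g has integer coefficients and constant term 1, the h_k are
    integers. Choosing for each root whether its exponent vanishes or not gives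
      sum_(i, s) V_(i,s) Y^s X^i
        = prod_j (1 + Y (zeta_j X + (zeta_j X)^2 + ...))
        = prod_j (1 - (1 - Y) zeta_j X) / (1 - zeta_j X)
        = g((1 - Y) X) h(X),
    so that V_(p,s) is the coefficient of Y^s in
    sum_k g_k h_(p-k) (1 - Y)^k ([coef_genpoly], [V_genpoly]).

    As V_(1,s) = 0 for s >= 2, the congruences of the theorem say that this
    polynomial in Y has degree at most 1 modulo p. Substituting 1 - Y for Y does
    not change the degree, and the g_k = a_k are units modulo p, so they say that
    h_(p-2), ..., h_(p-n) vanish modulo p ([genpoly_linear]).

    Work now over F_p. If h_(p-n), ..., h_(p-2) vanish, the truncation P of h to
    degrees below p - n has degree at most p - 1 - n, and g P agrees with g h = 1
    below degree p - 1. Hence g P = 1 - c X^(p-1) for some constant c, and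
    reversing the coefficients gives f | X^(p-1) - c. The constant is 1: as f
    divides X^p - c X, it divides f(X^p) - f(c X), and f(X^p) = f^p, so f divides
    f(c X), and comparing the coefficients of degree 0, n - 1 and n, none of
    which is zero, forces c = 1. This is where a_1 being a unit matters.
    Conversely f | X^(p-1) - 1 makes 1/g a polynomial of degree at most
    p - 1 - n divided by 1 - X^(p-1) ([dvdp_Xn1_series]). Finally
    f | X^(p-1) - 1 means that f is a product of distinct X - r with r != 0, that
    is, that f has n nonzero roots ([dvdp_Xn1_roots]). *)

Set Implicit Arguments.
Unset Strict Implicit.
Unset Printing Implicit Defensive.

Import GRing.Theory Num.Theory.

Local Open Scope ring_scope.

(** * Reversing the coefficients of a polynomial *)

Section Reversal.
Variable R : comNzRingType.
Implicit Types q r : {poly R}.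

(** For q of degree at most n this is X^n q(1/X). The bound n is a parameter, not
    the degree of q: this makes the operation linear, and multiplicative when
    the bounds add up. *)
Definition revp n q : {poly R} := \poly_(k < n.+1) q`_(n - k).

Lemma coef_revp n q k : (revp n q)`_k = if (k <= n)%N then q`_(n - k) else 0.
Proof. by rewrite coef_poly ltnS. Qed.

Lemma revp_is_linear n : linear (revp n).
Proof.
move=> c q r; apply/polyP => k.
rewrite coefD coefZ !coef_revp coefD coefZ.
by case: ifP => // _; rewrite mulr0 addr0.
Qed.

HB.instance Definition _ n :=
  GRing.isLinear.Build R {poly R} {poly R} _ (revp n) (revp_is_linear n).

Lemma revpXn n i : (i <= n)%N -> revp n 'X^i = 'X^(n - i).
Proof.
move=> le_in; apply/polyP => k; rewrite coef_revp !coefXn.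
have [le_kn|lt_nk] := leqP k n.
  rewrite -(eqn_add2r k) subnK // -[in RHS](eqn_add2r i) subnK //.
  by rewrite addnC eq_sym.
by case: eqP => // k_eq; move: lt_nk; rewrite k_eq ltnNge leq_subr.
Qed.

Lemma poly_expand q N : (size q <= N)%N -> q = \sum_(i < N) q`_i *: 'X^i.
Proof.
move=> sq; rewrite -poly_def; apply/polyP => i; rewrite coef_poly.
by case: ltnP => // /(leq_trans sq) /(nth_default _) ->.
Qed.

(** Both sides are bilinear, so it suffices to compare them on monomials. *)
Lemma revpM m n q r : (size q <= m.+1)%N -> (size r <= n.+1)%N ->
  revp (m + n) (q * r) = revp m q * revp n r.
Proof.
move=> sq sr; rewrite {1 2}(poly_expand sq) {1 2}(poly_expand sr).
rewrite !linear_sum !mulr_suml linear_sum; apply: eq_bigr => i _.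
rewrite !mulr_sumr linear_sum; apply: eq_bigr => j _ /=.
have le_im : (i <= m)%N by rewrite -ltnS.
have le_jn : (j <= n)%N by rewrite -ltnS.
rewrite -!scalerAl -!scalerAr -exprD !linearZ /= !revpXn ?leq_add //.
rewrite -scalerAl -scalerAr -exprD.
by rewrite subnDA -addnBAC // -addnBA.
Qed.

Lemma revpK n q : (size q <= n.+1)%N -> revp n (revp n q) = q.
Proof.
move=> sq; apply/polyP => k; rewrite !coef_revp leq_subr.
have [le_kn|lt_nk] := leqP k n; first by rewrite subKn.
by rewrite nth_default // (leq_trans sq).
Qed.

Lemma revp_prod_XsubC n (z : 'I_n -> R) :
  revp n (\prod_(j < n) ('X - (z j)%:P)) = \prod_(j < n) (1 - z j *: 'X).
Proof.
elim: n z => [|n IHn] z.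
  by rewrite !big_ord0 -(expr0 'X) revpXn.
rewrite !big_ord_recl -IHn (@revpM 1 n) ?size_XsubC //; last first.
  rewrite -(big_map (fun j : 'I_n => z (lift ord0 j)) predT
    (fun c => 'X - c%:P)).
  by rewrite size_prod_XsubC size_map /index_enum -enumT size_enum_ord.
congr (_ * _); rewrite linearB /= -{1}(expr1 'X) revpXn // -alg_polyC linearZ /=.
by rewrite -(expr0 'X) revpXn.
Qed.

End Reversal.

Lemma map_revp (R S : comNzRingType) (f : {rmorphism R -> S}) n q :
  map_poly f (revp n q) = revp n (map_poly f q).
Proof.
apply/polyP => k; rewrite !(coef_map, coef_revp) /=.
by case: ifP => // _; rewrite rmorph0.
Qed.

Lemma coef_comp_scaleX (R : comNzRingType) (c : R) (q : {poly R}) k :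
  (q \Po (c *: 'X))`_k = c ^+ k * q`_k.
Proof.
rewrite comp_polyE coef_sum.
transitivity ((\poly_(i < size q) (c ^+ i * q`_i))`_k).
  rewrite poly_def coef_sum; apply: eq_bigr => i _.
  by rewrite exprZn !coefZ mulrA [q`_i * _]mulrC.
by rewrite coef_poly; case: ltnP => // /(nth_default 0) ->; rewrite mulr0.
Qed.

(** * Congruence modulo a power of the variable *)

(** Congruence modulo X^N, phrased so that power series can be replaced by
    polynomial representatives. *)
Definition agree (R : comNzRingType) N (q r : {poly R}) :=
  forall k, (k < N)%N -> q`_k = r`_k.

Lemma agreeM (R : comNzRingType) N (q q' r r' : {poly R}) :
  agree N q q' -> agree N r r' -> agree N (q * r) (q' * r').
Proof.
move=> qq' rr' k lt_kN; rewrite !coefM; apply: eq_bigr => j _.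
rewrite qq' ?rr' //; first by rewrite (leq_ltn_trans (leq_subr _ _)).
by rewrite (leq_ltn_trans _ lt_kN) // -ltnS.
Qed.

Lemma agree_prod (R : comNzRingType) N (I : finType) (F G : I -> {poly R}) :
  (forall i, agree N (F i) (G i)) -> agree N (\prod_i F i) (\prod_i G i).
Proof. by move=> FG; apply: (big_ind2 (agree N)) => //; exact: agreeM. Qed.

Lemma map_agree (R S : comNzRingType) (f : {rmorphism R -> S}) N q r :
  agree N q r -> agree N (map_poly f q) (map_poly f r).
Proof. by move=> qr k lt_k; rewrite !coef_map qr. Qed.

(** The geometric series in 1 - g terminates modulo X^N because X divides
    1 - g. *)
Lemma truncated_inverse (R : comNzRingType) (g : {poly R}) N :
  g`_0 = 1 -> exists h, agree N (g * h) 1.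
Proof.
move=> g0; have [u uE] : exists u, 1 - g = 'X * u.
  exists (\poly_(i < size (1 - g)) (1 - g)`_i.+1); apply/polyP => -[|i].
    by rewrite coefXM coefB coef1 g0 subrr.
  rewrite coefXM coef_poly /=; case: ltnP => // le_si.
  by rewrite nth_default // (leq_trans le_si).
exists (\sum_(i < N) (1 - g) ^+ i) => k lt_kN.
have -> : g * \sum_(i < N) (1 - g) ^+ i = 1 - (1 - g) ^+ N.
  by rewrite -[RHS]opprB subrX1 addrAC subrr add0r mulNr opprK.
by rewrite uE exprMn coefB coefXnM lt_kN subr0.
Qed.

(** * The generating function of the sums over exponent tuples *)

Section GeneratingFunction.

(** The coefficient of X^i in g((1 - Y) X) h(X), a polynomial in Y. *)
Definition genpoly (R : comNzRingType) (g h : {poly R}) (i : nat) : {poly R} :=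
  \sum_(k < i.+1) (g`_k * h`_(i - k)) *: (1 - 'X) ^+ k.

Variables (R : comNzRingType) (n : nat) (z : 'I_n -> R).

(** Polynomials in X over the ring of polynomials in Y are used. The factor
    E j = 1 + Y sum_(1 <= e <= i) (z_j X)^e expands into the exponents of z_j,
    with one factor Y for each nonzero exponent, while
    (1 - z_j X) E j = 1 - (1 - Y) z_j X modulo X^(i+1), the geometric sum being
    telescoped. Multiplying over j and dividing by g gives the formula. *)
Lemma coef_genpoly (h : {poly R}) i s :
  agree i.+1 (\prod_(j < n) (1 - z j *: 'X) * h) 1 ->
  \sum_(e : {ffun 'I_n -> 'I_i.+1} | expo s e) \prod_(j < n) z j ^+ e j =
  (genpoly (\prod_(j < n) (1 - z j *: 'X)) h i)`_s.
Proof.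
set g := \prod_j _ => gh.
pose y : {poly R} := 'X.
pose w j : {poly {poly R}} := (z j)%:P *: 'X.
pose T (e : 'I_i.+1) j := y ^+ (val e != 0%N) *: w j ^+ e.
pose E j := \sum_(e < i.+1) T e j.
have Eprod : (\prod_j E j)`_i =
    \sum_(e : {ffun 'I_n -> 'I_i.+1} | (\sum_j e j)%N == i)
    (\prod_j z j ^+ e j)%:P * y ^+ #|[set j | val (e j) != 0%N]|.
  rewrite (bigA_distr_bigA (fun j e => T e j)) /= coef_sum [RHS]big_mkcond.
  apply: eq_bigr => e _.
  have -> : \prod_j T (e j) j =
     ((\prod_j z j ^+ e j)%:P * y ^+ #|[set j | val (e j) != 0%N]|)
       *: 'X^(\sum_j e j).
    rewrite -sum1dep_card !expr_sum [X in (_ * X) *: _]big_mkcond.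
    rewrite rmorph_prod /=.
    rewrite -big_split -mul_polyC rmorph_prod -big_split /=.
    apply: eq_bigr => j _.
    rewrite /T /w exprZn scalerA mul_polyC mulrC rmorphXn.
    by case: (val (e j) != 0)%N.
  by rewrite coefZ coefXn eq_sym; case: eqP; rewrite ?mulr1 ?mulr0.
have E1 j : (1 - w j) * E j = 1 - (1 - y) *: w j - y *: w j ^+ i.+1.
  have -> : E j = (1 - y%:P) + y *: \sum_(e < i.+1) w j ^+ e.
    rewrite /E !big_ord_recl /T /= expr0 !scale1r expr0 scalerDr -alg_polyC addrA.
    rewrite addrNK; congr (_ + _); rewrite scaler_sumr.
    by apply: eq_bigr => e _; rewrite expr1.
  have := subrX1 (w j) i.+1; set S := \sum_(_ < _) _ => wS.
  rewrite -!mul_polyC rmorphB /= -/y.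
  transitivity ((1 - w j) * (1 - y%:P) - y%:P * ((w j - 1) * S)).
    by ring.
  by rewrite -wS; ring.
pose G := map_poly polyC g; pose Hh := map_poly polyC h.
have GE : \prod_j (1 - w j) = G.
  rewrite /G rmorph_prod; apply: eq_bigr => j _.
  by rewrite rmorphB rmorph1 /= map_polyZ map_polyX.
have GHh : agree i.+1 (G * Hh) 1.
  move=> k lt_ki; rewrite -rmorphM coef_map gh // !coef1.
  by case: (k == 0)%N; rewrite ?rmorph1 ?rmorph0.
have GY : G \Po ((1 - y) *: 'X) = \prod_j (1 - (1 - y) *: w j).
  rewrite -GE rmorph_prod; apply: eq_bigr => j _.
  rewrite rmorphB rmorph1 /= comp_polyZ comp_polyX; congr (1 - _).
  by rewrite !scalerA mulrC.
have Ei : agree i.+1 (\prod_j E j) ((G \Po ((1 - y) *: 'X)) * Hh).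
  move=> k lt_ki; rewrite -[\prod_j E j]mul1r.
  have GHh' : agree i.+1 1 (G * Hh) by move=> l lt_li; rewrite GHh.
  rewrite (agreeM GHh' (fun _ _ => erefl)) // mulrAC GY -GE -big_split /=.
  apply: agreeM lt_ki => //; apply: agree_prod => j l lt_li.
  rewrite E1 coefB; suff -> : (y *: w j ^+ i.+1)`_l = 0 by rewrite subr0.
  by rewrite exprZn !coefZ coefXn ltn_eqF // !mulr0.
have -> : genpoly g h i = (\prod_j E j)`_i.
  rewrite Ei // coefM; apply: eq_bigr => k _.
  by rewrite coef_comp_scaleX !coef_map /= -mul_polyC rmorphM; ring.
rewrite Eprod coef_sum /expo big_mkcondr /=; apply: eq_bigr => e _.
by rewrite coefCM coefXn eq_sym; case: eqP; rewrite ?mulr1 ?mulr0.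
Qed.
End GeneratingFunction.

Lemma map_genpoly (R S : comNzRingType) (f : {rmorphism R -> S}) g h i :
  map_poly f (genpoly g h i) = genpoly (map_poly f g) (map_poly f h) i.
Proof.
rewrite rmorph_sum; apply: eq_bigr => k _.
by rewrite /= map_polyZ rmorphXn rmorphB rmorph1 /= map_polyX !coef_map rmorphM.
Qed.

Lemma size_one_sub_X (F : fieldType) : size (1 - 'X : {poly F}) = 2.
Proof. by rewrite -opprB size_polyN size_XsubC. Qed.

(** Substituting 1 - Y for Y preserves the degree and turns [genpoly g h i] into
    the polynomial with coefficients g_k h_(i-k); both conditions say that the
    degree is at most 1. *)
Lemma genpoly_linear (F : fieldType) (g h : {poly F}) n i :
  (size g <= n.+1)%N -> (n <= i)%N ->
  (forall s, (2 <= s <= n)%N -> (genpoly g h i)`_s = 0) <->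
  (forall s, (2 <= s <= n)%N -> g`_s * h`_(i - s) = 0).
Proof.
move=> sg le_ni; pose G : {poly F} := \poly_(k < i.+1) (g`_k * h`_(i - k)).
have GE : genpoly g h i = G \Po (1 - 'X).
  rewrite /G poly_def rmorph_sum; apply: eq_bigr => k _.
  by rewrite /= comp_polyZ rmorphXn /= comp_polyX.
have sG : size (genpoly g h i) = size G.
  by rewrite GE size_comp_poly2 // size_one_sub_X.
have G_s s : (s <= n)%N -> G`_s = g`_s * h`_(i - s).
  by move=> le_sn; rewrite coef_poly ltnS (leq_trans le_sn).
have sGn : (size G <= n.+1)%N.
  apply/leq_sizeP => k lt_nk; rewrite coef_poly; case: ltnP => // _.
  by rewrite nth_default ?mul0r // (leq_trans sg).
have small (q : {poly F}) : (size q <= n.+1)%N ->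
    (forall s, (2 <= s <= n)%N -> q`_s = 0) <-> (size q <= 2)%N.
  move=> sq; split=> [q0|/leq_sizeP q0 s /andP[le2s _]]; last exact: q0.
  apply/leq_sizeP => s le2s; have [le_sn|lt_ns] := leqP s n.
    by rewrite q0 // le2s.
  by rewrite nth_default // (leq_trans sq).
rewrite small ?sG // -small //; split=> H s s2n; move: (H s s2n);
  by rewrite G_s //; case/andP: s2n.
Qed.

(** * Divisors of X^(q-1) - 1 over the field with q elements *)

Section FiniteField.
Variable F : finFieldType.
Implicit Types f g h q : {poly F}.

Lemma poly_Frobenius f : f ^+ #|F| = f \Po 'X^#|F|.
Proof.
have q_pchar : [pchar {poly F}].-nat #|F|.
  rewrite (eq_pnat _ (pchar_poly F)).
  have [p p_pr pF] := finPcharP F; rewrite (eq_pnat _ (pcharf_eq pF)).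
  by rewrite (card_pprimeChar pF) pnatX pnat_id.
elim/poly_ind: f => [|f c IHf].
  by rewrite comp_poly0 expr0n gtn_eqF // (ltnW (finNzRing_gt1 F)).
rewrite exprDn_pchar // exprMn IHf -rmorphXn /= expf_card.
by rewrite comp_polyD comp_polyM comp_polyX comp_polyC.
Qed.

Lemma dvdp_comp_sub f q r : q - r %| (f \Po q) - (f \Po r).
Proof.
elim/poly_ind: f => [|f c IHf]; first by rewrite !comp_poly0 subrr dvdp0.
rewrite !comp_polyD !comp_polyM !comp_polyX !comp_polyC.
have -> : (f \Po q) * q + c%:P - ((f \Po r) * r + c%:P) =
  (f \Po q) * (q - r) + ((f \Po q) - (f \Po r)) * r by ring.
by apply: dvdp_add; [apply: dvdp_mull | apply: dvdp_mulr].
Qed.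

(** Comparing degrees, f(c X) = l f for a constant l. The constant coefficient
    gives l = 1, then the coefficients of degrees n - 1 and n give
    c^(n-1) = 1 = c^n. *)
Lemma dvdp_scaleX f n c : size f = n.+1 -> (0 < n)%N -> f`_0 != 0 ->
  f`_n.-1 != 0 -> f %| f \Po (c *: 'X) -> c = 1.
Proof.
move=> sf n_gt0 f0 fn1 /dvdpP[q fcE].
have f_neq0 : f != 0 by rewrite -size_poly_eq0 sf.
have fn : f`_n != 0.
  by rewrite -[n]/(n.+1.-1) -sf -lead_coefE lead_coef_eq0.
have sfc : (size (f \Po (c *: 'X)) <= size f)%N.
  by apply/leq_sizeP => k le_k; rewrite coef_comp_scaleX nth_default // mulr0.
have q_neq0 : q != 0.
  apply: contraNneq f0 => q0; have := coef_comp_scaleX c f 0.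
  by rewrite fcE q0 mul0r coef0 expr0 mul1r => <-.
have [l qE] : exists l, q = l%:P.
  exists q`_0; apply: size1_polyC; move: sfc.
  by rewrite fcE size_mul // sf addnS /= -[X in (_ <= X)%N]add1n leq_add2r.
have coefE k : c ^+ k * f`_k = l * f`_k.
  by rewrite -coef_comp_scaleX fcE qE coefCM.
have l1 : l = 1 by apply: (mulIf f0); rewrite -coefE expr0.
have ck k : f`_k != 0 -> c ^+ k = 1.
  by move=> fk; apply: (mulIf fk); rewrite coefE l1.
by have := ck _ fn; rewrite -(prednK n_gt0) exprS (ck _ fn1) mulr1.
Qed.

(** Frobenius shows that f divides f(c X): f divides X^q - c X, which divides
    f(X^q) - f(c X), and f(X^q) = f^q. *)
Lemma dvdp_XnsubC f n N c : size f = n.+1 -> (0 < n)%N -> f`_0 != 0 ->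
  f`_n.-1 != 0 -> #|F| = N.+1 -> f %| 'X^N - c%:P -> c = 1.
Proof.
move=> sf n_gt0 f0 fn1 cardF f_dvd; apply: (dvdp_scaleX sf) => //.
have f_dvd_exp : f %| f ^+ #|F| by rewrite cardF dvdp_exp ?dvdpp.
rewrite -(dvdp_subr _ f_dvd_exp) poly_Frobenius.
apply: dvdp_trans (dvdp_comp_sub _ _ _).
by rewrite cardF exprSr -mul_polyC -mulrBl dvdp_mulr.
Qed.

(** With g the reciprocal of f and h = 1/g: if f Q' = X^(n+m) - 1 then
    g Q = 1 - X^(n+m) for the reciprocal Q of Q', so h agrees with Q, of degree at
    most m, below degree n + m. If conversely h has such a gap, cutting h off at
    degree m gives P with g P = 1 - c X^(n+m), whence f | X^(n+m) - c, and c = 1 by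
    [dvdp_XnsubC]. *)
Lemma dvdp_Xn1_series f h n m : f \is monic -> size f = n.+1 -> (0 < n)%N ->
    f`_0 != 0 -> f`_n.-1 != 0 -> #|F| = (n + m).+1 ->
    agree (n + m) (revp n f * h) 1 ->
  f %| 'X^(n + m) - 1 <-> (forall k, (m < k < n + m)%N -> h`_k = 0).
Proof.
move=> f_mon sf n_gt0 f0 fn1 cardF gh.
have nm_gt0 : (0 < n + m)%N by rewrite addn_gt0 n_gt0.
split=> [/dvdpP[q qf] k /andP[lt_mk lt_k]|h0].
  have sq : (size q <= m.+1)%N.
    have := size_XnsubC (1 : F) nm_gt0; rewrite qf size_Mmonic // ?sf.
      by rewrite addnS /= addnC => /eqP; rewrite -addnS eqn_add2l => /eqP ->.
    apply: contraTneq isT => q0.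
    by have := size_XnsubC (1 : F) nm_gt0; rewrite qf q0 mul0r size_poly0.
  have gQ : revp n f * revp m q = 1 - 'X^(n + m).
    rewrite -revpM ?sf // mulrC -qf linearB /= revpXn // subnn -(expr0 'X).
    by rewrite revpXn // subn0.
  have gQ1 : agree (n + m) 1 (revp n f * revp m q).
    by move=> l lt_l; rewrite gQ coefB coefXn ltn_eqF // subr0.
  have := agreeM gQ1 (fun l _ => erefl h`_l) lt_k.
  rewrite mul1r mulrAC => ->.
  rewrite (agreeM gh (fun l _ => erefl (revp m q)`_l)) //.
  by rewrite mul1r coef_revp leqNgt lt_mk.
pose P : {poly F} := \poly_(k < m.+1) h`_k.
have hP : agree (n + m) P h.
  move=> k lt_k; rewrite coef_poly; case: ltnP => // lt_mk.
  by rewrite h0 // lt_mk.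
have gP : agree (n + m) (revp n f * P) 1.
  by move=> k lt_k; rewrite (agreeM (fun _ _ => erefl) hP) // gh.
pose c := - (revp n f * P)`_(n + m).
have sgP : (size (revp n f * P)%R <= (n + m).+1)%N.
  apply: leq_trans (size_polyMleq _ _) _.
  have := leq_add (size_poly n.+1 (fun k => f`_(n - k)))
    (size_poly m.+1 (fun k => h`_k)).
  by rewrite addnS -subn1 leq_subLR add1n addSn.
have gPE : revp n f * P = 1 - c *: 'X^(n + m).
  apply/polyP => k; rewrite coefB coefZ coefXn.
  have [lt_k|gt_k|->] := ltngtP k (n + m)%N.
  - by rewrite gP // mulr0 subr0.
  - rewrite (nth_default _ (leq_trans sgP gt_k)) coef1.
    by rewrite gtn_eqF ?(leq_ltn_trans _ gt_k) // mulr0 subrr.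
  - by rewrite coef1 gtn_eqF // mulr1 sub0r opprK.
have fE : f * revp m P = 'X^(n + m) - c%:P.
  have := congr1 (revp (n + m)) gPE.
  rewrite revpM ?size_poly // revpK ?sf // => ->.
  rewrite linearB linearZ /= revpXn // subnn -{1}(expr0 'X) revpXn //.
  by rewrite subn0 alg_polyC.
have f_dvd : f %| 'X^(n + m) - c%:P by rewrite -fE dvdp_mulr.
by have := f_dvd; rewrite (dvdp_XnsubC sf _ _ _ cardF f_dvd).
Qed.

(** X^q - X is the product of all the X - x, so the divisors of X^(q-1) - 1 are,
    up to constants, the products of X - x over sets of nonzero x. *)
Lemma dvdp_Xn1_roots f N : f`_0 != 0 -> #|F| = N.+1 ->
  f %| 'X^N - 1 <-> #|[set x | (x != 0) && root f x]| = (size f).-1.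
Proof.
move=> f0 cardF.
have f_neq0 : f != 0 by apply: contraNneq f0 => ->; rewrite coef0.
have f0' : root f 0 = false by apply: negbTE; rewrite rootE horner_coef0.
have -> : [set x | (x != 0) && root f x] = [set x | root f x].
  by apply/setP => x; rewrite !inE; case: eqP => [->|]; rewrite ?f0'.
split=> [f_dvd|card_roots].
  have : f %| \prod_x ('X - x%:P).
    rewrite -finField_genPoly cardF exprSr -[X in _ - X]mul1r -mulrBl.
    exact: dvdp_mulr.
  case/dvdp_prod_XsubC=> b f_eqp.
  have fr x : root f x = (x \in mask b (index_enum F)).
    by rewrite (eqp_root f_eqp) root_prod_XsubC.
  rewrite (eqp_size f_eqp) size_prod_XsubC /= -(card_uniqP _); last first.
    by rewrite mask_uniq // index_enum_uniq.
  by apply: eq_card => x; rewrite inE fr.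
pose s := enum [set x | root f x].
have s_root : all (root f) s by apply/allP => x; rewrite mem_enum inE.
have s_uniq : uniq_roots s by rewrite uniq_rootsE enum_uniq.
have : \prod_(x <- s) ('X - x%:P) %= f.
  rewrite -dvdp_size_eqp ?uniq_roots_dvdp // size_prod_XsubC -cardE card_roots.
  by rewrite prednK // size_poly_gt0.
move=> f_eqp; rewrite -(eqp_dvdl _ f_eqp) uniq_roots_dvdp //.
apply/allP => x; rewrite mem_enum inE => fx.
have x_neq0 : x != 0 by apply: contraTneq fx => ->; rewrite f0'.
rewrite rootE !hornerE subr_eq0; apply/eqP/(mulIf x_neq0).
by rewrite mul1r -exprSr -cardF expf_card.
Qed.

End FiniteField.

(** * The integers V and their reduction modulo p *)

Lemma revp_fpoly n a :
  revp n (fpoly n a) = 1 + \sum_(1 <= k < n.+1) a k *: 'X^k.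
Proof.
rewrite linearD linear_sum /= revpXn // subnn expr0; congr (_ + _).
rewrite !big_nat; apply: eq_bigr => k /andP[_ le_kn].
by rewrite linearZ /= revpXn ?leq_subr // subKn.
Qed.

Lemma coef_revp_fpoly n a k : (k <= n)%N ->
  (revp n (fpoly n a))`_k = if k == 0%N then 1 else a k.
Proof.
move=> le_kn; rewrite revp_fpoly coefD coef1 coef_sum.
under eq_bigr do rewrite coefZ coefXn.
case: k le_kn => [|k] lt_kn /=.
  rewrite big_nat big1 ?addr0 // => k /andP[k_gt0 _].
  by rewrite ltn_eqF // mulr0.
rewrite add0r (bigD1_seq k.+1) ?mem_index_iota ?iota_uniq //= eqxx mulr1.
by rewrite big1 ?addr0 // => j /negbTE; rewrite eq_sym => ->; rewrite mulr0.
Qed.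

Lemma size_fpoly n a : size (fpoly n a) = n.+1.
Proof.
rewrite size_polyDl size_polyXn // ltnS; apply: (leq_trans (size_sum _ _ _)).
rewrite big_nat; apply/bigmax_leqP_seq => k _ /andP[k_gt0 le_kn].
rewrite (leq_trans (size_scale_leq _ _)) // size_polyXn ltn_subrL k_gt0.
by rewrite (leq_trans k_gt0).
Qed.

Lemma fpoly_monic n a : fpoly n a \is monic.
Proof.
apply/monicP; rewrite lead_coefE size_fpoly /=.
by have := coef_revp_fpoly a (leq0n n); rewrite coef_revp subn0.
Qed.

Lemma coef_fpoly n a k : (1 <= k <= n)%N -> (fpoly n a)`_(n - k) = a k.
Proof.
case/andP=> k_gt0 le_kn; have := coef_revp_fpoly a le_kn.
by rewrite coef_revp le_kn gtn_eqF.
Qed.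

(** The identity [coef_genpoly] holds between complex numbers; both sides are the
    images of integers. *)
Lemma V_genpoly (R : realType) n a (zeta : 'I_n -> R[i]) (h : {poly int}) i s :
  roots_of a zeta -> agree i.+1 (revp n (fpoly n a) * h) 1 -> (s <= i)%N ->
  V zeta i s = (genpoly (revp n (fpoly n a)) h i)`_s.
Proof.
move=> zetaP gh le_si; apply: (@intr_inj R[i]).
rewrite (V_VC zetaP) /VC ltnNge le_si /= -coef_map map_genpoly map_revp zetaP.
rewrite revp_prod_XsubC; apply: coef_genpoly.
move: (map_agree (intr : {rmorphism int -> R[i]}) gh).
by rewrite rmorphM rmorph1 /= map_revp zetaP revp_prod_XsubC.
Qed.

Lemma V_eq0 (R : realType) n (zeta : 'I_n -> R[i]) i s :
  (i < s)%N -> V zeta i s = 0.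
Proof. by move=> lt_is; rewrite /V /VC lt_is floor0. Qed.

Lemma eqz_mod_Fp p (x y : int) : prime p ->
  (x == y %[mod p])%Z = (x%:~R == y%:~R :> 'F_p).
Proof.
move=> p_pr; rewrite eqz_mod_dvd (dvdz_pcharf (pchar_Fp p_pr)).
by rewrite rmorphB subr_eq0.
Qed.

Lemma card_roots_mod p (f : {poly int}) : prime p ->
  #|[set x : 'I_p | (0 < x)%N && (f.[(x : nat)%:Z] == 0 %[mod p])%Z]| =
  #|[set x : 'F_p | (x != 0) && root (map_poly intr f) x]|.
Proof.
move=> p_pr; rewrite -(card_imset _ (@cast_ord_inj _ _ (esym (Fp_cast p_pr)))).
apply: eq_card => x; rewrite -(cast_ordK (Fp_cast p_pr) x).
move: (cast_ord (Fp_cast p_pr) x) => y.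
rewrite mem_imset; last exact: cast_ord_inj.
rewrite !inE eqz_mod_Fp // rmorph0 /root -lt0n; congr (_ && _).
rewrite -horner_map /=; congr (_.[_] == _).
by rewrite -[RHS]natr_Zp.
Qed.

Theorem theorem2p3 (R : realType) (p n : nat) (a : nat -> int)
    (zeta : 'I_n -> R[i])
    (p_prime : prime p) (p_gt2 : (2 < p)%N)
    (n_ge1 : (1 <= n)%N) (n_le : (n <= p - 2)%N)
    (a_ndvd : ~~ (p %| \prod_(1 <= k < n.+1) a k)%Z)
    (zetaP : roots_of a zeta) :
  #|[set x : 'I_p | (0 < x)%N &&
      ((fpoly n a).[(x : nat)%:Z] == 0 %[mod p])%Z]| = n
  <->
  (forall i : nat, (2 <= i <= n)%N ->
     (V zeta p i = V zeta 1 i %[mod p])%Z).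
Proof.
pose F := 'F_p; pose red : {rmorphism int -> F} := intr.
have [m pE] : exists m, p = (n + m).+1.
  by exists (p - n.+1)%N; lia.
have cardF : #|F| = (n + m).+1 by rewrite card_Fp.
have a_neq0 k : (1 <= k <= n)%N -> red (a k) != 0.
  move=> k1n; apply: contraNneq a_ndvd => ak0.
  rewrite (dvdz_pcharf (pchar_Fp p_prime)) -/(red _) rmorph_prod.
  by rewrite (bigD1_seq k) ?mem_index_iota ?iota_uniq //= ak0 mul0r.
pose f := map_poly red (fpoly n a).
have f_monic : f \is monic by rewrite monic_map ?fpoly_monic.
have sf : size f = n.+1.
  rewrite size_map_poly_id0 ?size_fpoly // (monicP (fpoly_monic n a)).
  by rewrite rmorph1 oner_eq0.
have f0 : f`_0 != 0.
  by rewrite coef_map -(subnn n) coef_fpoly ?n_ge1 ?a_neq0 ?n_ge1 /=.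
have fn1 : f`_n.-1 != 0.
  by rewrite coef_map -subn1 coef_fpoly ?a_neq0 ?n_ge1 /=.
(* The coefficient of degree p is the last one that enters [genpoly _ _ p]. *)
have [h gh] := truncated_inverse p.+1 (coef_revp_fpoly a (leq0n n)).
pose hp := map_poly red h.
have ghp : agree (n + m) (revp n f * hp) 1.
  move: (map_agree red gh); rewrite rmorphM rmorph1 /= map_revp => ghp k lt_k.
  by apply: ghp; lia.
have rev_f : revp n f = map_poly red (revp n (fpoly n a)) by rewrite map_revp.
rewrite card_roots_mod // -[X in _ = X]/(n.+1.-1) -sf.
rewrite -(dvdp_Xn1_roots f0 cardF).
rewrite (dvdp_Xn1_series f_monic sf n_ge1 f0 fn1 cardF ghp).
have V_red s : (2 <= s <= n)%N ->
  (V zeta p s = V zeta 1 s %[mod p])%Z <-> (genpoly (revp n f) hp p)`_s = 0.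
  case/andP=> s_ge2 le_sn; rewrite (@V_eq0 _ _ _ 1) //.
  rewrite (V_genpoly zetaP gh); last by lia.
  set v := (genpoly _ h p)`_s.
  have vE : (v == 0 %[mod p])%Z = ((genpoly (revp n f) hp p)`_s == 0).
    by rewrite eqz_mod_Fp // rmorph0 rev_f -map_genpoly coef_map.
  by split=> /eqP; [rewrite vE | rewrite -vE] => /eqP.
(* The gap m < k < n + m in the coefficients of the inverse series is, by
   k = p - s, the range 2 <= s <= n. *)
split=> [hp0 s s2n|V0 k /andP[lt_mk lt_k]].
  apply/V_red => //; move: s s2n.
  apply/(genpoly_linear _ (size_poly _ _)); first by lia.
  by move=> s s2n; rewrite hp0 ?mulr0 //; lia.
have s2n : (2 <= p - k <= n)%N by lia.
have : (revp n f)`_(p - k) * hp`_(p - (p - k)) = 0.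
  move: (p - k)%N s2n.
  apply/(genpoly_linear _ (size_poly _ _)); first by lia.
  by move=> s s2n; apply/V_red => //; exact: V0.
rewrite subKn; last by lia.
case/andP: s2n => /ltnW s_gt0 le_sn /eqP; rewrite mulf_eq0 rev_f coef_map.
rewrite coef_revp_fpoly // gtn_eqF // (negbTE (a_neq0 _ _)) ?s_gt0 //=.
by move/eqP.
Qed.
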